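(* Let $A$ be a locally compact abelian group and $M$ an LC $A$-module. Then $\{0\}\subseteq \mathrm{W}^\flat(M)\subseteq \Omega^\sharp(M)\subseteq M$. If moreover $A$ is compactly generated, then $\mathrm{W}^\flat(M)$ is a compact parafinite submodule, $\Omega^\sharp(M)$ is open and $M/\Omega^\sharp(M)$ is purely discrete, and the subquotient $\Omega^\sharp(M)/\mathrm{W}^\flat(M)$ is sheer.
   Context: All topological groups are Hausdorff. An LC $A$-module is an LCA group $M$ with a continuous action of the LCA group $A$ by topological automorphisms. An LC $A$-module is compact parafinite if it is compact and has no nonzero finite quotient module; it is purely discrete if it is discrete and has no nonzero finite submodule. $\mathrm{W}^\flat(M)$ (reduced polycompact radical) is the sum of all compact parafinite submodules of $M$. $\Omega^\sharp(M)$ (augmented codiscrete radical) is the intersection of all open submodules $U\subseteq M$ such that $M/U$ is purely discrete. $M$ is sheer if $\mathrm{W}^\flat(M)=\{0\}$ and $\Omega^\sharp(M)=M$. *)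

(* Defs.v *)
From HB Require Import structures.
From mathcomp Require Import all_boot all_order all_algebra.
From mathcomp Require Import all_classical all_reals all_analysis.
Set Implicit Arguments. Unset Strict Implicit. Unset Printing Implicit Defensive.
Import Order.TTheory GRing.Theory Num.Theory.
Local Open Scope classical_set_scope.
Local Open Scope ring_scope.

Definition LCA (A : topologicalZmodType) : Prop :=
  hausdorff_space A /\ locally_compact [set: A].

Definition is_subgroup (G : zmodType) (H : set G) : Prop :=
  H 0 /\ (forall x y, H x -> H y -> H (x - y)).

Definition gen_subgroup (G : zmodType) (S : set G) : set G :=
  [set x | forall H, is_subgroup H -> S `<=` H -> H x].

Definition compactly_generated (A : topologicalZmodType) : Prop :=
  exists K : set A, compact K /\ gen_subgroup K = [set: A].

Record lcmod (A : topologicalZmodType) := LCMod {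
  lc_car :> topologicalZmodType;
  act : A -> lc_car -> lc_car;
  lc_hausdorff : hausdorff_space lc_car;
  lc_locally_compact : locally_compact [set: lc_car];
  act_add : forall a (x y : lc_car), act a (x + y) = act a x + act a y;
  act_zero : forall x : lc_car, act 0 x = x;
  act_comp : forall a b (x : lc_car), act (a + b) x = act a (act b x);
  act_continuous : continuous (fun p : A * lc_car => act p.1 p.2)
}.
Arguments act {A} l _ _.

Section Defs.
Variables (A : topologicalZmodType) (M : lcmod A).

Definition submodule (S : set M) : Prop :=
  is_subgroup S /\ (forall a x, S x -> S (act M a x)).

Definition coset (K : set M) (x : M) : set M := [set y | K (y - x)].

Definition finite_index (H K : set M) : Prop :=
  exists s : seq M, H `<=` \bigcup_(x in [set` s]) coset K x.

(** Compact parafinite submodule: compact, and no nonzero finite quotient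
    module (quotient modules of N are N/K, K a closed submodule of N). *)
Definition compact_parafinite (N : set M) : Prop :=
  submodule N /\ compact N /\
  (forall K, submodule K -> closed K -> K `<=` N -> finite_index N K ->
     N `<=` K).

Definition purely_discrete : Prop :=
  (forall x : M, open [set x]) /\
  (forall S, submodule S -> finite_set S -> S `<=` [set 0]).

(** For a submodule U, the quotient M/U is purely discrete: every point of
    M/U is open in the quotient topology (i.e. every coset of U is open),
    and M/U has no nonzero finite submodule (submodules of M/U are V/U
    with V a submodule containing U). *)
Definition quotient_purely_discrete (U : set M) : Prop :=
  (forall x, open (coset U x)) /\
  (forall V, submodule V -> U `<=` V -> finite_index V U -> V `<=` U).

Definition Wflat : set M :=
  gen_subgroup (\bigcup_(N in [set N | compact_parafinite N]) N).

Definition Omegasharp : set M :=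
  [set x | forall U, submodule U -> open U -> quotient_purely_discrete U -> U x].

Definition sheer : Prop := Wflat = [set 0] /\ Omegasharp = [set: M].

End Defs.

(** [pi] realizes the subquotient H/L (L <= H submodules of M) as the
    LC A-module Q: on H, pi is an A-equivariant additive surjection onto Q
    with kernel L, continuous for the subspace topology of H and open
    (images of relatively open subsets of H are open). *)
Definition is_subquotient (A : topologicalZmodType) (M : lcmod A)
    (H L : set M) (Q : lcmod A) (pi : M -> Q) : Prop :=
  (forall x y, H x -> H y -> pi (x + y) = pi x + pi y) /\
  (forall a x, H x -> pi (act M a x) = act Q a (pi x)) /\
  pi @` H = [set: Q] /\
  (forall x, H x -> (pi x = 0 <-> L x)) /\
  {within H, continuous pi} /\
  (forall O : set M, open O -> open (pi @` (H `&` O))).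

Arguments Wflat {A} M.
Arguments Omegasharp {A} M.
Arguments purely_discrete {A} M.
Arguments sheer {A} M.

(* Main.v *)
Require Import Defs.
From HB Require Import structures.
From mathcomp Require Import all_boot all_order all_algebra.
From mathcomp Require Import finmap all_classical all_analysis.
Set Implicit Arguments. Unset Strict Implicit. Unset Printing Implicit Defensive.
Import GRing.Theory.
Local Open Scope classical_set_scope.
Local Open Scope ring_scope.

(** Let K be a compact symmetric generating set of A.

    Openness of Omega#: M has an open subgroup C which is compact modulo the
    intersection of all open subgroups, so K C meets only finitely many cosets of
    C.  Among the open submodules U with M/U purely discrete pick one for which
    K C /\ U meets as few of these cosets as possible.  If U' <= U is another such
    submodule, minimality gives K C /\ U <= (C /\ U) + U', hence (C /\ U) + U' is a
    submodule in which U' has finite index, and so C /\ U <= U'.  Thus Omega#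
    contains the open set C /\ U.

    Compactness of W_flat is the dual argument: some compact subgroup C is open in
    the closure of the union of all compact subgroups.  With C' the set of x in C
    such that K x <= C, pick a compact parafinite N0 for which C' + N0 contains as
    many of the finitely many cosets of C' in C as possible.  For every compact
    parafinite N >= N0, the set N /\ (C + N0) is then K-stable, so it is a submodule
    of finite index in N, and N <= C + N0.

    Sheerness of H/L, for H = Omega# and L = W_flat, holds because both kinds of
    submodules pull back to M: the preimage of a compact parafinite submodule of H/L
    is compact parafinite since L is, hence it lies in L; the preimage of an open
    submodule of H/L with purely discrete quotient has a purely discrete quotient in
    M since M/H is purely discrete, hence it contains H. *)

Lemma exists_minimal_trace (T : Type) (I : choiceType) (P : set T) (F : set I)
    (h : T -> set I) : finite_set F -> P !=set0 ->
  exists2 x, P x & forall y, P y -> F `&` h y `<=` h x -> F `&` h x `<=` h y.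
Proof.
move=> /finite_fsetP[X ->] [x0 Px0].
pose trace y := [fset i in X | `[< h y i >]]%fset.
have exn : exists n, `[< exists2 x, P x & #|` trace x|%fset = n >].
  by exists #|` trace x0|%fset; apply/asboolP; exists x0.
case: (ex_minnP exn) => n /asboolP[x Px <-] xmin.
exists x => // y Py yx i [Xi hxi].
have trace_yx : (trace y `<=` trace x)%fset.
  apply/fsubsetP => j; rewrite !inE => /andP[Xj /asboolP hyj].
  by rewrite Xj; apply/asboolP; exact: yx.
have /eqP trace_eq : trace y == trace x.
  by rewrite eqEfcard trace_yx xmin//; apply/asboolP; exists y.
have : i \in trace x by rewrite !inE; apply/andP; split=> //; exact/asboolP.
by rewrite -trace_eq !inE => /andP[_ /asboolP].
Qed.

Lemma exists_maximal_trace (T : Type) (I : choiceType) (P : set T) (F : set I)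
    (h : T -> set I) : finite_set F -> P !=set0 ->
  exists2 x, P x & forall y, P y -> F `&` h x `<=` h y -> F `&` h y `<=` h x.
Proof.
move=> fF /(exists_minimal_trace (fun y => ~` h y) fF)[x Px xmin].
exists x => // y Py xy i [Fi hyi]; apply: contrapT => nhxi.
by apply: (xmin y Py) hyi => // j [Fj nhyj] hxj; apply/nhyj/xy.
Qed.

Lemma compact_finite_subcover (T : topologicalType) (K : set T) (I : choiceType)
    (D : set I) (f : I -> set T) :
  compact K -> (forall i, D i -> open (f i)) -> K `<=` \bigcup_(i in D) f i ->
  exists F : set I,
    [/\ finite_set F, F `<=` D & K `<=` \bigcup_(i in F) f i].
Proof.
move=> cK of_ Kf; have [->|/set0P[k _]] := eqVneq K set0.
  by exists set0; split=> //; exact: finite_set0.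
pose pT : ptopologicalType := HB.pack (Topological.sort T) (isPointed.Build T k).
have coverK : @cover_compact pT K by rewrite -compact_cover.
have [F FD KF] := coverK _ _ _ of_ Kf.
exists [set` F]; split=> // i Fi.
by have := FD _ Fi; rewrite inE.
Qed.

Lemma finite_bigcap_open (T : topologicalType) (I : choiceType) (F : set I)
    (f : I -> set T) :
  finite_set F -> (forall i, F i -> open (f i)) -> open (\bigcap_(i in F) f i).
Proof.
move=> /finite_fsetP[X ->] of_; rewrite openE => x fx.
apply: filter_bigI => i Xi; apply: open_nbhs_nbhs; split; first exact: of_.
exact: fx.
Qed.

Lemma compact_image2 (X Y Z : topologicalType) (f : X -> Y -> Z) (S : set X)
    (T : set Y) :
  continuous (fun p : X * Y => f p.1 p.2) -> compact S -> compact T ->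
  compact [set f x y | x in S & y in T].
Proof.
move=> cf cS cT; rewrite image2E; apply: continuous_compact; last exact: compact_setX.
apply: continuous_subspaceT; rewrite (_ : uncurry f = fun p => f p.1 p.2)//.
by apply/funext => -[].
Qed.

Lemma locally_compact_nbhs (T : topologicalType) (x : T) :
  locally_compact [set: T] -> exists2 V, nbhs x V & compact V.
Proof. by move=> /(_ x I)[V]; rewrite withinET => nV [cV _]; exists V. Qed.

Section Subgroups.
Context (G : zmodType).
Implicit Types (H K S T : set G).

Lemma subgroup0 H : is_subgroup H -> H 0. Proof. by case. Qed.

Lemma subgroupB H x y : is_subgroup H -> H x -> H y -> H (x - y).
Proof. by case=> _; apply. Qed.

Lemma subgroupN H x : is_subgroup H -> H x -> H (- x).
Proof. by move=> sH Hx; rewrite -sub0r; apply: subgroupB => //; exact: subgroup0. Qed.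

Lemma subgroupD H x y : is_subgroup H -> H x -> H y -> H (x + y).
Proof.
by move=> sH Hx Hy; rewrite -(opprK y); apply: subgroupB => //; exact: subgroupN.
Qed.

Lemma subgroup_set0 : is_subgroup [set 0 : G].
Proof. by split=> // x y -> ->; rewrite subr0. Qed.

Lemma subgroup_setT : is_subgroup [set: G]. Proof. by []. Qed.

Lemma subgroup_bigcap (I : Type) (D : set I) (F : I -> set G) :
  (forall i, D i -> is_subgroup (F i)) -> is_subgroup (\bigcap_(i in D) F i).
Proof.
move=> sF; split=> [i /sF[]//|x y Fx Fy i Di].
by apply: subgroupB; [exact: sF|exact: Fx|exact: Fy].
Qed.

Lemma subgroupI H K : is_subgroup H -> is_subgroup K -> is_subgroup (H `&` K).
Proof.
move=> sH sK; split; first by split; exact: subgroup0.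
by move=> x y [? ?] [? ?]; split; exact: subgroupB.
Qed.

Lemma subgroup_gen S : is_subgroup (gen_subgroup S).
Proof.
split=> [H [] //|x y Sx Sy H sH SH].
by apply: subgroupB => //; [exact: Sx|exact: Sy].
Qed.

Lemma sub_gen_subgroup S : S `<=` gen_subgroup S.
Proof. by move=> x Sx H _; exact. Qed.

Definition sumset S T : set G := [set x + y | x in S & y in T].

Lemma mem_sumset S T x y : S x -> T y -> sumset S T (x + y).
Proof. by move=> Sx Ty; exists x => //; exists y. Qed.

Lemma sumsetP S T x : sumset S T x <-> exists2 s, S s & T (x - s).
Proof.
split=> [[s Ss [t Tt <-]]|[s Ss Txs]]; first by exists s => //; rewrite addrC addKr.
by rewrite -(subrK s x) addrC; exact: mem_sumset.
Qed.

Lemma sumset_subl S T : T 0 -> S `<=` sumset S T.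
Proof. by move=> T0 x Sx; rewrite -(addr0 x); exact: mem_sumset. Qed.

Lemma sumset_subr S T : S 0 -> T `<=` sumset S T.
Proof. by move=> S0 x Tx; rewrite -(add0r x); exact: mem_sumset. Qed.

Lemma sumset_sub H S T :
  is_subgroup H -> S `<=` H -> T `<=` H -> sumset S T `<=` H.
Proof. by move=> sH SH TH _ [x /SH Hx [y /TH Hy <-]]; exact: subgroupD. Qed.

Lemma sumset_subgroupK S H : is_subgroup H -> sumset (sumset S H) H `<=` sumset S H.
Proof.
move=> sH _ [_ [x Sx [y Hy <-]] [z Hz <-]]; rewrite -addrA.
by apply: mem_sumset => //; exact: subgroupD.
Qed.

Lemma subgroup_sumset H K :
  is_subgroup H -> is_subgroup K -> is_subgroup (sumset H K).
Proof.
move=> sH sK; split; first by rewrite -(addr0 0); apply: mem_sumset; exact: subgroup0.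
move=> _ _ [x Hx [y Ky <-]] [x' Hx' [y' Ky' <-]].
by rewrite opprD addrACA; apply: mem_sumset; exact: subgroupB.
Qed.

End Subgroups.

Definition additive_on (G G' : zmodType) (H : set G) (f : G -> G') : Prop :=
  forall x y, H x -> H y -> f (x - y) = f x - f y.

Section AdditiveOnSubgroup.
Context (G G' : zmodType) (H : set G) (f : G -> G').
Hypotheses (sH : is_subgroup H) (fB : additive_on H f).

Lemma additive_on0 : f 0 = 0.
Proof. by rewrite -(subrr 0) fB ?subrr//; exact: subgroup0. Qed.

Lemma subgroup_preimage (S : set G') :
  is_subgroup S -> is_subgroup (H `&` f @^-1` S).
Proof.
move=> sS; split; first by split=> /=; rewrite ?additive_on0; exact: subgroup0.
by move=> x y [Hx Sx] [Hy Sy]; split=> /=; rewrite ?fB//; exact: subgroupB.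
Qed.

Lemma subgroup_image (S : set G) :
  is_subgroup S -> S `<=` H -> is_subgroup (f @` S).
Proof.
move=> sS SH; split; first by exists 0; [exact: subgroup0|exact: additive_on0].
move=> _ _ [x Sx <-] [y Sy <-]; exists (x - y); first exact: subgroupB.
by apply: fB; exact: SH.
Qed.

End AdditiveOnSubgroup.

Section TopologicalGroups.
Context (G : topologicalZmodType).
Implicit Types (H S T U V : set G).

Lemma subr_continuous (a : G) : continuous (fun x : G => x - a).
Proof.
move=> x; apply: (@continuous_comp _ _ _ (fun x => (x, a)) (fun x : G * G => x.1 - x.2)).
  by apply: cvg_pair => /=; [exact: cvg_id|exact: cvg_cst].
exact: sub_continuous.
Qed.

Lemma open_translate (a : G) U : open U -> open [set x | U (x - a)].
Proof. by apply: open_comp => x _; exact: subr_continuous. Qed.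

Lemma nbhs_translate (a : G) U : nbhs 0 U -> nbhs a [set x | U (x - a)].
Proof. by move=> U0; apply: (@subr_continuous a a); rewrite subrr. Qed.

Lemma nbhs0N U : nbhs 0 U -> nbhs 0 [set x : G | U (- x)].
Proof. by move=> U0; apply: (@opp_continuous G 0); rewrite oppr0. Qed.

Lemma nbhs0B V : nbhs 0 V ->
  exists2 U, nbhs 0 U & forall x y, U x -> U y -> V (x - y).
Proof.
rewrite -[X in nbhs X V](subrr 0) => /(@sub_continuous G (0, 0))[[U U'] [/= U0 U'0] UV].
exists (U `&` U'); first exact: filterI.
by move=> x y [Ux _] [_ U'y]; exact: (UV (x, y)).
Qed.

Lemma compact_sumset S T : compact S -> compact T -> compact (sumset S T).
Proof. by apply: compact_image2; exact: add_continuous. Qed.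

Lemma open_sumset S T : open T -> open (sumset S T).
Proof.
move=> oT; have -> : sumset S T = \bigcup_(s in S) [set x | T (x - s)].
  by apply/seteqP; split=> x /sumsetP.
by apply: bigcup_open => s _; exact: open_translate.
Qed.

Lemma locally_compact_of_nbhs0 V : hausdorff_space G -> nbhs 0 V -> compact V ->
  locally_compact [set: G].
Proof.
move=> hG V0 cV x _; exists (sumset [set x] V); last first.
  have cxV : compact (sumset [set x] V) by apply: compact_sumset cV; exact: compact_set1.
  by split=> //; exact: compact_closed.
rewrite withinET; apply: filterS (nbhs_translate x V0) => y Vyx.
by apply/sumsetP; exists x.
Qed.

Lemma compact_sub_finite_sumset K S U : compact K -> K `<=` closure S -> nbhs 0 U ->
  exists F : set G, [/\ finite_set F, F `<=` S & K `<=` sumset F U].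
Proof.
move=> cK KS U0.
have [||F [fF FS KF]] :=
    @compact_finite_subcover _ _ _ S (fun s => [set x | U° (x - s)]) cK.
- by move=> s _; apply: open_translate; exact: open_interior.
- move=> x /KS cSx; have /cSx[s [Ss Us]] := nbhs_translate x (nbhs0N (nbhs_interior U0)).
  by exists s => //; move: Us; rewrite /= opprB.
exists F; split=> // x /KF[s Fs /interior_subset Uxs].
by apply/sumsetP; exists s.
Qed.

Lemma subgroup_open H : is_subgroup H -> nbhs 0 H -> open H.
Proof.
move=> sH H0; rewrite openE => x Hx; apply: filterS (nbhs_translate x H0).
by move=> y /= Hyx; rewrite -(subrK x y); exact: subgroupD.
Qed.

Lemma open_subgroup_nbhs0 H : is_subgroup H -> open H -> nbhs 0 H.
Proof. by move=> sH oH; apply: open_nbhs_nbhs; split=> //; exact: subgroup0. Qed.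

Lemma open_subgroup_closed H : is_subgroup H -> open H -> closed H.
Proof.
move=> sH oH x cHx; have H0 := open_subgroup_nbhs0 sH oH.
have [y [Hy Hyx]] := cHx _ (nbhs_translate x H0).
by rewrite -(subKr y x); exact: subgroupB.
Qed.

Lemma subgroup_closure H : is_subgroup H -> is_subgroup (closure H).
Proof.
move=> sH; split; first by apply: subset_closure; exact: subgroup0.
move=> x y cx cy B /(@sub_continuous G (x, y))[[V W] [/= Vx Wy] VW].
have [x' [Hx' Vx']] := cx _ Vx; have [y' [Hy' Wy']] := cy _ Wy.
by exists (x' - y'); split; [exact: subgroupB|exact: (VW (x', y'))].
Qed.

Definition open_subgroups : set (set G) := [set H | is_subgroup H /\ open H].

Definition open_core : set G := \bigcap_(H in open_subgroups) H.

Lemma subgroup_open_core : is_subgroup open_core.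
Proof. by apply: subgroup_bigcap => H []. Qed.

Lemma open_subgroup_avoiding_compact B : compact B -> B `<=` ~` open_core ->
  exists2 O, open_subgroups O & O `&` B = set0.
Proof.
move=> cB; rewrite setC_bigcap => Bcore.
have [|F [fF FG BF]] := compact_finite_subcover cB _ Bcore.
  by move=> H [sH oH]; apply: closed_openC; exact: open_subgroup_closed.
exists (\bigcap_(H in F) H).
  split; first by apply: subgroup_bigcap => H /FG[].
  by apply: finite_bigcap_open => // H /FG[].
apply/seteqP; split=> // x [Ox /BF[H FH nHx]].
by apply: nHx; exact: Ox.
Qed.

(* Van Dantzig's theorem for the quotient by [open_core], without forming the quotient.
   Since [O] avoids the compact set [V `\` W], the differences of elements of [U]
   that lie in [O] are in [W]; hence [O `&` W] is a subgroup. *)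
Lemma open_subgroup_compact_mod_core : locally_compact [set: G] ->
  exists C V, [/\ open_subgroups C, compact V & C `<=` sumset open_core V].
Proof.
move=> /(@locally_compact_nbhs _ 0)[V V0 cV].
have [U U0 UV] := nbhs0B V0; have sD := subgroup_open_core.
have UsubV : U `<=` V.
  by move=> u Uu; rewrite -(subr0 u); apply: UV => //; exact: nbhs_singleton.
pose W := sumset open_core U°.
have oW : open W by apply: open_sumset; exact: open_interior.
have [||O [sO oO] OV] := @open_subgroup_avoiding_compact (V `&` ~` W).
- by apply: compact_closedI => //; exact: open_closedC.
- move=> x [_ nWx] Dx; apply: nWx; apply: sumset_subl Dx.
  by apply: nbhs_singleton; exact: nbhs_interior.
have OVW x : O x -> V x -> W x.
  move=> Ox Vx; apply: contrapT => nWx.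
  by have : (O `&` (V `&` ~` W)) x by []; rewrite OV.
exists (O `&` W), V; split=> //; last first.
  by move=> x [_ [d Dd [u /interior_subset/UsubV Vu <-]]]; exact: mem_sumset.
split; last exact: openI.
split.
  have O0 := subgroup0 sO.
  by split=> //; apply: OVW => //; exact: nbhs_singleton.
move=> x y [Ox /sumsetP[d Dd Uxd]] [Oy /sumsetP[e De Uye]].
split; first exact: subgroupB.
have DO : open_core `<=` O by move=> z; exact.
have /sumsetP[c Dc Uc] : W (x - d - (y - e)).
  apply: OVW; last by apply: UV; exact: interior_subset.
  by apply: subgroupB => //; apply: subgroupB => //; exact: DO.
apply/sumsetP; exists (d - e + c).
  by apply: (subgroupD sD) => //; exact: (subgroupB sD).
by rewrite opprD addrA [- (d - e)]opprD addrACA -opprD.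
Qed.

Definition compact_elements : set G :=
  [set x | exists N, [/\ is_subgroup N, compact N & N x]].

Lemma subgroup_compact_elements : is_subgroup compact_elements.
Proof.
split; first by exists [set 0]; split=> //; [exact: subgroup_set0|exact: compact_set1].
move=> x y [N [sN cN Nx]] [N' [sN' cN' Ny]]; exists (sumset N N').
split; [exact: subgroup_sumset|exact: compact_sumset|].
by apply: mem_sumset => //; exact: subgroupN.
Qed.

Lemma finite_sub_compact_subgroup F : finite_set F -> F `<=` compact_elements ->
  exists N, [/\ is_subgroup N, compact N & F `<=` N].
Proof.
move=> /finite_seqP[s ->]; elim: s => [|x s IH] s_compact.
  by exists [set 0]; split=> //; [exact: subgroup_set0|exact: compact_set1].
have [N [sN cN Nx]] : compact_elements x by apply: s_compact; exact: mem_head.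
have [|N' [sN' cN' s_sub_N']] := IH.
  by move=> y ys; apply: s_compact; rewrite /= inE ys orbT.
exists (sumset N N'); split; [exact: subgroup_sumset|exact: compact_sumset|].
move=> y /=; rewrite inE => /orP[/eqP ->|/s_sub_N'].
  by apply: sumset_subl => //; exact: subgroup0.
by apply: sumset_subr; exact: subgroup0.
Qed.

(* By density, the finitely many translates of [V] needed to cover the
   differences of elements of [VH] can be centred at compact elements; the
   centres lie in one compact subgroup [N], and [VH + N] is a subgroup. *)
Lemma compact_subgroup_open_in_compact_elements : locally_compact [set: G] ->
  exists C U, [/\ is_subgroup C, compact C, C `<=` closure compact_elements,
    nbhs 0 U & closure compact_elements `&` U `<=` C].
Proof.
move=> /(@locally_compact_nbhs _ 0)[V V0 cV].
pose H := closure compact_elements; pose VH := V `&` H.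
have sH : is_subgroup H by apply: subgroup_closure; exact: subgroup_compact_elements.
have cVH : compact VH by apply: compact_closedI => //; exact: closed_closure.
pose D := [set x - y | x in VH & y in VH].
have cD : compact D by apply: compact_image2 => //; exact: sub_continuous.
have DH : D `<=` H by move=> _ [x [_ Hx] [y [_ Hy] <-]]; exact: (subgroupB sH).
have [F [fF Fce DF]] := compact_sub_finite_sumset cD DH V0.
have [N [sN cN FN]] := finite_sub_compact_subgroup fF Fce.
have NH : N `<=` H by move=> x Nx; apply: subset_closure; exists N.
have D_VHN : D `<=` sumset VH N.
  move=> x Dx; have /sumsetP[b Fb Vxb] := DF _ Dx.
  rewrite -(subrK b x); apply: mem_sumset; last exact: FN.
  by split=> //; apply: (subgroupB sH); [exact: DH|exact/NH/FN].
exists (sumset VH N), V; split=> //.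
- split.
    apply: sumset_subl; first exact: subgroup0.
    by split; [exact: nbhs_singleton|exact: subgroup0].
  move=> _ _ [v VHv [n Nn <-]] [v' VHv' [n' Nn' <-]]; rewrite opprD addrACA.
  apply: sumset_subgroupK => //; apply: mem_sumset; last exact: subgroupB.
  by apply: D_VHN; exists v => //; exists v'.
- exact: compact_sumset.
- by apply: sumset_sub => // x [].
- by move=> x [Hx Vx]; apply: sumset_subl => //; exact: subgroup0.
Qed.

End TopologicalGroups.

Arguments open_subgroups {G}.
Arguments open_core {G}.
Arguments compact_elements {G}.

Section Modules.
Context (A : topologicalZmodType) (M : lcmod A).
Implicit Types (S T N U K F : set M) (a : A) (x y : M).

Lemma act0 a : act M a 0 = 0.
Proof. by apply: (addrI (act M a 0)); rewrite -act_add !addr0. Qed.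

Lemma actN a x : act M a (- x) = - act M a x.
Proof. by apply: (addrI (act M a x)); rewrite -act_add !subrr act0. Qed.

Lemma actB a x y : act M a (x - y) = act M a x - act M a y.
Proof. by rewrite act_add actN. Qed.

Lemma act_additive_on a S : additive_on S (act M a).
Proof. by move=> x y _ _; exact: actB. Qed.

Lemma act_continuousr a : continuous (act M a).
Proof.
move=> x; apply: (@continuous_comp _ _ _ (fun x => (a, x)) (fun p => act M p.1 p.2)).
  by apply: cvg_pair => /=; [exact: cvg_cst|exact: cvg_id].
exact: act_continuous.
Qed.

Lemma open_core_act a x : open_core x -> open_core (act M a x).
Proof.
move=> Dx H [sH oH]; apply: (Dx (act M a @^-1` H)); split.
  rewrite -[X in is_subgroup X]setTI.
  exact: (subgroup_preimage (subgroup_setT M) (@act_additive_on a setT) sH).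
by apply: open_comp => // y _; exact: act_continuousr.
Qed.

Lemma compact_elements_act a x :
  compact_elements x -> compact_elements (act M a x).
Proof.
move=> [N [sN cN Nx]]; exists (act M a @` N); split; last by exists x.
  exact: (subgroup_image sN (@act_additive_on a N) sN).
by apply: continuous_compact => //; apply: continuous_subspaceT; exact: act_continuousr.
Qed.

Lemma closure_act S a : (forall x, S x -> S (act M a x)) ->
  forall x, closure S x -> closure S (act M a x).
Proof.
move=> aS x cx B /act_continuousr /cx[y [Sy By]].
by exists (act M a y); split=> //; exact: aS.
Qed.

Lemma submodule_set0 : submodule ([set 0] : set M).
Proof. by split=> [|a x ->]; [exact: subgroup_set0|exact: act0]. Qed.

Lemma submodule_bigcap (I : Type) (D : set I) (F : I -> set M) :
  (forall i, D i -> submodule (F i)) -> submodule (\bigcap_(i in D) F i).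
Proof.
move=> mF; split; first by apply: subgroup_bigcap => i /mF[].
by move=> a x Fx i Di; have [_ aF] := mF i Di; apply: aF; exact: Fx.
Qed.

Lemma submoduleI S T : submodule S -> submodule T -> submodule (S `&` T).
Proof.
move=> [sS aS] [sT aT]; split; first exact: subgroupI.
by move=> a x [Sx Tx]; split; [exact: aS|exact: aT].
Qed.

Lemma submodule_sumset S T : submodule S -> submodule T -> submodule (sumset S T).
Proof.
move=> [sS aS] [sT aT]; split; first exact: subgroup_sumset.
by move=> a _ [x Sx [y Ty <-]]; rewrite act_add; apply: mem_sumset; [exact: aS|exact: aT].
Qed.

Lemma submodule_closure S : submodule S -> submodule (closure S).
Proof.
move=> [sS aS]; split; first exact: subgroup_closure.
by move=> a; apply: closure_act; exact: aS.
Qed.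

Lemma finite_indexP S K :
  finite_index S K <-> exists2 F, finite_set F & S `<=` sumset F K.
Proof.
split=> [[s Ss]|[F /finite_seqP[s ->] SF]].
  exists [set` s]; first exact: finite_seq.
  by move=> x /Ss[y sy Kxy]; apply/sumsetP; exists y.
by exists s => x /SF/sumsetP[y sy Kxy]; exists y.
Qed.

Lemma finite_indexS S S' K K' : S' `<=` S -> K `<=` K' ->
  finite_index S K -> finite_index S' K'.
Proof.
by move=> SS KK [s Ss]; exists s => x /SS /Ss[y ys Ky]; exists y => //; exact: KK.
Qed.

Lemma finite_index_sumset S K : is_subgroup K ->
  finite_index S K -> finite_index (sumset S K) K.
Proof.
move=> sK /finite_indexP[F fF SF]; apply/finite_indexP; exists F => // x SKx.
by apply: sumset_subgroupK => //; apply: (image2_subset SF) SKx.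
Qed.

Lemma finite_index_representatives S K : is_subgroup K -> finite_index S K ->
  exists F, [/\ finite_set F, F `<=` S & S `<=` sumset F K].
Proof.
move=> sK /finite_indexP[F fF SF].
have /choice[r rP] z : exists y, forall x, S x -> K (x - z) -> S y /\ K (y - z).
  have [[y Sy Ky]|nS] := pselect (exists2 x, S x & K (x - z)); first by exists y.
  by exists 0 => x Sx Kxz; case: nS; exists x.
exists (S `&` r @` F); split; first exact/finite_setIr/finite_image.
  by move=> ? [].
move=> x /[dup] Sx /SF/sumsetP[z Fz Kxz]; have [Srz Krz] := rP z x Sx Kxz.
apply/sumsetP; exists (r z); first by split=> //; exists z.
by rewrite -(subrKA z) -[z - r z]opprB; exact: subgroupB.
Qed.

Lemma finite_index_setI S K : is_subgroup S -> is_subgroup K ->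
  finite_index S K -> finite_index S (S `&` K).
Proof.
move=> sS sK /(finite_index_representatives sK)[F [fF FS SF]].
apply/finite_indexP; exists F => // x /[dup] Sx /SF/sumsetP[y Fy Kxy].
apply/sumsetP; exists y => //; split=> //.
by apply: subgroupB => //; exact: FS.
Qed.

Lemma compact_finite_index S U : compact S -> nbhs 0 U -> finite_index S U.
Proof.
move=> cS U0; apply/finite_indexP.
by have [F [fF _ SF]] := compact_sub_finite_sumset cS (@subset_closure _ S) U0; exists F.
Qed.

Lemma compact_subgroup_finite_index S U K : compact S -> is_subgroup S ->
  nbhs 0 U -> S `&` U `<=` K -> finite_index S K.
Proof.
move=> cS sS U0 SUK; apply/finite_indexP.
have [F [fF FS SF]] := compact_sub_finite_sumset cS (@subset_closure _ S) U0.
exists F => // x /[dup] Sx /SF/sumsetP[y Fy Uxy].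
apply/sumsetP; exists y => //; apply: SUK; split=> //.
by apply: subgroupB => //; exact: FS.
Qed.

Lemma coset_open U x : open U -> open (coset U x).
Proof. exact: open_translate. Qed.

(* For [U] minimal, every coset of [C] met by [X `&` U] is also met by the smaller
   [X `&` U']. *)
Lemma finite_index_minimal_trace (P : set (set M)) X C : is_subgroup C ->
  finite_index X C -> P !=set0 -> (forall U, P U -> is_subgroup U) ->
  exists2 U, P U & forall U', P U' -> U' `<=` U -> X `&` U `<=` sumset (C `&` U) U'.
Proof.
move=> sC /finite_indexP[F fF XF] P0 sP.
pose trace U : set M := [set z | exists2 y, (X `&` U) y & C (y - z)].
have [U PU Umin] := exists_minimal_trace trace fF P0.
exists U => // U' PU' U'U x [Xx Ux]; have /sumsetP[z Fz Cxz] := XF x Xx.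
have [||y [_ U'y] Cyz] := Umin U' PU' _ z.
- by move=> j [_ [y [Xy U'y] Cyj]]; exists y => //; split=> //; exact: U'U.
- by split=> //; exists x.
rewrite -(subrK y x); apply: mem_sumset => //; split.
  by rewrite -(subrKA z) -[z - y]opprB; exact: subgroupB.
by apply: subgroupB; [exact: sP|exact: Ux|exact: U'U].
Qed.

(* For [N] maximal, [C' + N] contains every coset of [C'] in [C] met by a larger [N']. *)
Lemma finite_index_maximal_trace (P : set (set M)) C C' : is_subgroup C' ->
  finite_index C C' -> P !=set0 ->
  exists2 N, P N & forall N', P N' -> N `<=` N' -> C `&` N' `<=` sumset C' N.
Proof.
move=> sC' /finite_indexP[F fF CF] P0.
have [N PN Nmax] := exists_maximal_trace (fun N => sumset C' N) fF P0.
exists N => // N' PN' NN' x [/CF/sumsetP[z Fz C'xz] N'x].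
have [||c C'c [n Nn cnE]] := Nmax N' PN' _ z.
- by move=> y [_]; exact: image2_subset.
- split=> //; rewrite -(subrK x z) -opprB.
  by apply: mem_sumset => //; exact: subgroupN.
rewrite -(subrK z x) -cnE addrA; apply: mem_sumset => //.
by rewrite cnE; exact: subgroupD.
Qed.

End Modules.

Section SubgroupsAndQuotients.
Context (G : topologicalZmodType) (H : set G).
Hypothesis sH : is_subgroup H.

(* The proof argument lets the instance below be inferred from the predicate. *)
Definition subgroup_pred of is_subgroup H : {pred G} := mem H.

Fact subgroup_pred_zmod_closed : zmod_closed (subgroup_pred sH).
Proof.
split=> [|x y]; rewrite /subgroup_pred !inE; first exact: subgroup0.
exact: subgroupB.
Qed.

HB.instance Definition _ :=
  GRing.isZmodClosed.Build G (subgroup_pred sH) subgroup_pred_zmod_closed.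

Definition subgroup_type : Type := {x : G | x \in subgroup_pred sH}.
Local Notation S := subgroup_type.

HB.instance Definition _ := Topological.copy S (set_type H).
HB.instance Definition _ := [isSub of S for sval].
HB.instance Definition _ := [SubChoice_isSubZmodule of S by <:].

Lemma subgroup_valP (u : S) : H (val u).
Proof. by have := valP u; rewrite inE. Qed.

Lemma subgroup_valD (u v : S) : val (u + v) = val u + val v.
Proof. exact: (raddfD \val). Qed.

Lemma subgroup_val_preimage (K : set G) :
  is_subgroup K -> is_subgroup (val @^-1` K : set S).
Proof.
move=> sK; rewrite -[X in is_subgroup X]setTI.
apply: (subgroup_preimage (subgroup_setT S) _ sK) => u v _ _.
exact: (raddfB \val).
Qed.

Lemma subgroup_val_continuous : continuous (val : S -> G).
Proof. exact: (@initial_continuous S G val). Qed.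

Lemma continuous_to_subgroup (X : topologicalType) (f : X -> S) :
  continuous (val \o f) -> continuous f.
Proof. exact: (@continuous_comp_initial S X G val f). Qed.

Fact subgroup_sub_continuous : continuous (fun u : S * S => u.1 - u.2).
Proof.
apply: continuous_to_subgroup => u.
pose valval (v : S * S) : G * G := (val v.1, val v.2).
rewrite (_ : _ \o _ = (fun p : G * G => p.1 - p.2) \o valval).
  apply: continuous_comp; last exact: sub_continuous.
  apply: cvg_pair; (apply: cvg_comp; last exact: subgroup_val_continuous).
    exact: cvg_fst.
  exact: cvg_snd.
by apply/funext => -[v w]; exact: (raddfB \val).
Qed.

HB.instance Definition _ :=
  PreTopologicalNmodule_isTopologicalZmodule.Build S subgroup_sub_continuous.

Definition subgroup_proj : G -> S := insubd 0.

Lemma subgroup_projK x : H x -> val (subgroup_proj x) = x.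
Proof. by move=> Hx; rewrite insubdK// /subgroup_pred inE. Qed.

Lemma subgroup_valK : cancel val subgroup_proj.
Proof. exact: valKd. Qed.

Lemma subgroup_projD x y : H x -> H y ->
  subgroup_proj (x + y) = subgroup_proj x + subgroup_proj y.
Proof.
move=> Hx Hy; apply: val_inj; rewrite subgroup_valD !subgroup_projK//.
exact: subgroupD.
Qed.

Lemma subgroup_proj_image (X : set G) : subgroup_proj @` (H `&` X) = val @^-1` X.
Proof.
apply/seteqP; split=> [_ [x [Hx Xx] <-]|u Xu]; first by rewrite /= subgroup_projK.
by exists (val u); [split=> //; exact: subgroup_valP|exact: subgroup_valK].
Qed.

Lemma subgroup_proj_continuous : {within H, continuous subgroup_proj}.
Proof.
apply/subspace_sigL_continuousP.
rewrite (_ : sigL H subgroup_proj = id); first by move=> u; exact: cvg_id.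
by apply/funext => u; exact: subgroup_valK.
Qed.

Fact subgroup_hausdorff : hausdorff_space G -> hausdorff_space S.
Proof.
move=> hG u v cuv; apply: val_inj; apply: hG => X Y uX vY.
have [w [Xw Yw]] := cuv _ _ (subgroup_val_continuous uX) (subgroup_val_continuous vY).
by exists (val w).
Qed.

Fact subgroup_locally_compact : hausdorff_space G -> locally_compact [set: G] ->
  closed H -> locally_compact [set: S].
Proof.
move=> hG /(@locally_compact_nbhs _ 0)[V V0 cV] cH.
apply: (@locally_compact_of_nbhs0 S (val @^-1` V)).
- exact: subgroup_hausdorff.
- by apply: subgroup_val_continuous; rewrite raddf0.
- rewrite -subgroup_proj_image; apply: continuous_compact.
    by apply: continuous_subspaceW subgroup_proj_continuous => ? [].
  by rewrite setIC; exact: compact_closedI.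
Qed.

Definition quotient_group : Type := quotient_topology (Quotient.quot (subgroup_pred sH)).
Local Notation Q := quotient_group.
Local Notation pi := (\pi_Q%qT : G -> Q).

HB.instance Definition _ := Topological.on Q.
HB.instance Definition _ := Quotient.on Q.
(* [GRing.Zmodule.copy] would bring in a choice structure other than that of
   [quotient_topology]. *)
HB.instance Definition _ := GRing.isZmodule.Build Q
  (@Quotient.addqA _ (subgroup_pred sH)) (@Quotient.addqC _ (subgroup_pred sH))
  (@Quotient.add0q _ (subgroup_pred sH)) (@Quotient.addNq _ (subgroup_pred sH)).

Lemma quotient_group_piB x y : pi (x - y) = pi x - pi y.
Proof. exact: (raddfB \pi_(Quotient.quot (subgroup_pred sH)))%qT. Qed.

Lemma quotient_group_pi0 : pi 0 = 0.
Proof. by rewrite -(subrr 0) quotient_group_piB subrr. Qed.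

Lemma quotient_group_piD x y : pi (x + y) = pi x + pi y.
Proof. exact: (raddfD \pi_(Quotient.quot (subgroup_pred sH)))%qT. Qed.

Lemma quotient_group_pi_eq x y : pi x = pi y <-> H (x - y).
Proof.
have -> : H (x - y) <-> x - y \in subgroup_pred sH by rewrite inE.
by rewrite Quotient.idealrBE; split=> [pixy|/eqP//]; apply/eqP.
Qed.

Lemma quotient_group_open (O : set G) : open O -> open (pi @` O).
Proof.
move=> oO; rewrite /open /= /quotient_open.
rewrite (_ : _ @^-1` _ = sumset H O); first exact: open_sumset.
apply/seteqP; split=> [x [y Oy /quotient_group_pi_eq Hyx]|_ [h Hh [y Oy <-]]].
  rewrite -(subrK y x); apply: mem_sumset => //.
  by rewrite -opprB; exact: subgroupN.
exists y => //; apply/quotient_group_pi_eq.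
by rewrite opprD addrCA subrr addr0; exact: subgroupN.
Qed.

Lemma quotient_group_nbhs x (V : set G) : nbhs x V -> nbhs (pi x) (pi @` V).
Proof.
rewrite nbhsE => -[B [oB Bx] BV].
have : nbhs (pi x) (pi @` B).
  by apply: open_nbhs_nbhs; split; [exact: quotient_group_open|exists x].
by apply: filterS; exact: image_subset.
Qed.

Lemma quotient_group_piP (u : Q) : exists x, u = pi x.
Proof. by exists (repr u); rewrite reprK. Qed.

Fact quotient_group_sub_continuous : continuous (fun u : Q * Q => u.1 - u.2).
Proof.
move=> [u v] B /=; have [x ->] := quotient_group_piP u.
have [y ->] := quotient_group_piP v; rewrite -quotient_group_piB.
move=> /(@pi_continuous _ _ (x - y)) /(@sub_continuous G (x, y)) [[V W] [/= Vx Wy] VW].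
exists (pi @` V, pi @` W); first by split; exact: quotient_group_nbhs.
move=> [_ _] [/= [x' Vx' <-] [y' Wy' <-]].
by have := VW (x', y') (conj Vx' Wy'); rewrite /= quotient_group_piB.
Qed.

HB.instance Definition _ :=
  PreTopologicalNmodule_isTopologicalZmodule.Build Q quotient_group_sub_continuous.

Fact quotient_group_hausdorff : closed H -> hausdorff_space Q.
Proof.
move=> cH u v; have [x ->] := quotient_group_piP u; have [y ->] := quotient_group_piP v.
move=> cxy; apply/quotient_group_pi_eq; apply: contrapT => nH.
have : nbhs (x - y) (~` H).
  by apply: open_nbhs_nbhs; split=> //; exact: closed_openC.
move=> /(@sub_continuous G (x, y)) [[V W] [/= Vx Wy] VW].
have [_ [[x' Vx' <-] [y' Wy' yx]]] :=
  cxy _ _ (quotient_group_nbhs Vx) (quotient_group_nbhs Wy).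
apply: (VW (x', y')) => //=.
exact/quotient_group_pi_eq.
Qed.

Fact quotient_group_locally_compact : locally_compact [set: G] -> closed H ->
  locally_compact [set: Q].
Proof.
move=> /(@locally_compact_nbhs _ 0)[V V0 cV] cH.
apply: (@locally_compact_of_nbhs0 _ (pi @` V)).
- exact: quotient_group_hausdorff.
- by have := quotient_group_nbhs V0; rewrite quotient_group_pi0.
- apply: continuous_compact cV; apply: continuous_subspaceT; exact: pi_continuous.
Qed.

End SubgroupsAndQuotients.

Section SubmodulesAndQuotientModules.
Context (A : topologicalZmodType) (M : lcmod A) (H : set M).
Hypotheses (mH : submodule H) (cH : closed H).

Local Notation sH := (proj1 mH).
Local Notation S := (subgroup_type sH).
Local Notation proj := (subgroup_proj sH).

Definition submodule_act (a : A) (u : S) : S := proj (act M a (val u)).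

Lemma submodule_val_act a u : val (submodule_act a u) = act M a (val u).
Proof.
have [_ aH] := mH; apply: subgroup_projK; apply: aH; exact: subgroup_valP.
Qed.

Fact submodule_actD a u v :
  submodule_act a (u + v) = submodule_act a u + submodule_act a v.
Proof.
by apply: val_inj; rewrite submodule_val_act !subgroup_valD !submodule_val_act act_add.
Qed.

Fact submodule_act_zero u : submodule_act 0 u = u.
Proof. by apply: val_inj; rewrite submodule_val_act act_zero. Qed.

Fact submodule_act_comp a b u :
  submodule_act (a + b) u = submodule_act a (submodule_act b u).
Proof. by apply: val_inj; rewrite !submodule_val_act act_comp. Qed.

Fact submodule_act_continuous :
  continuous (fun p : A * S => submodule_act p.1 p.2).
Proof.
apply: continuous_to_subgroup => p.
pose idval (q : A * S) : A * M := (q.1, val q.2).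
rewrite (_ : _ \o _ = (fun q : A * M => act M q.1 q.2) \o idval).
  apply: continuous_comp; last exact: act_continuous.
  apply: cvg_pair; first exact: cvg_fst.
  by apply: cvg_comp; [exact: cvg_snd|exact: subgroup_val_continuous].
by apply/funext => -[a u]; exact: submodule_val_act.
Qed.

Definition submodule_lcmod : lcmod A :=
  LCMod (subgroup_hausdorff (@lc_hausdorff A M))
    (subgroup_locally_compact (@lc_hausdorff A M) (@lc_locally_compact A M) cH)
    submodule_actD submodule_act_zero submodule_act_comp submodule_act_continuous.

Local Notation Q := (quotient_group sH).
Local Notation pi := (\pi_Q%qT : M -> Q).

Definition quotient_act (a : A) (u : Q) : Q := pi (act M a (repr u)).

Lemma quotient_act_pi a x : quotient_act a (pi x) = pi (act M a x).
Proof.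
have [_ aH] := mH; apply/quotient_group_pi_eq; rewrite -actB; apply: aH.
by apply/(quotient_group_pi_eq sH); rewrite reprK.
Qed.

Fact quotient_actD a u v : quotient_act a (u + v) = quotient_act a u + quotient_act a v.
Proof.
have [x ->] := quotient_group_piP u; have [y ->] := quotient_group_piP v.
by rewrite -quotient_group_piD !quotient_act_pi act_add quotient_group_piD.
Qed.

Fact quotient_act_zero u : quotient_act 0 u = u.
Proof. by rewrite /quotient_act act_zero reprK. Qed.

Fact quotient_act_comp a b u :
  quotient_act (a + b) u = quotient_act a (quotient_act b u).
Proof.
by have [x ->] := quotient_group_piP u; rewrite !quotient_act_pi act_comp.
Qed.

Fact quotient_act_continuous : continuous (fun p : A * Q => quotient_act p.1 p.2).
Proof.
move=> [a u] B /=; have [x ->] := quotient_group_piP u.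
rewrite quotient_act_pi => /(@pi_continuous _ _ (act M a x)).
move=> /(@act_continuous A M (a, x)) [[V W] [/= Va Wx] VW].
exists (V, pi @` W); first by split=> //; exact: quotient_group_nbhs.
move=> [b _] [/= Vb [y Wy <-]].
by have := VW (b, y) (conj Vb Wy); rewrite /= quotient_act_pi.
Qed.

Definition quotient_lcmod : lcmod A :=
  LCMod (quotient_group_hausdorff cH)
    (quotient_group_locally_compact (@lc_locally_compact A M) cH)
    quotient_actD quotient_act_zero quotient_act_comp quotient_act_continuous.

End SubmodulesAndQuotientModules.

Section SubquotientExistence.
Context (A : topologicalZmodType) (M : lcmod A) (H L : set M).
Hypotheses (mH : submodule H) (cH : closed H).
Hypotheses (mL : submodule L) (cL : closed L).

Local Notation N := (submodule_lcmod mH cH).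

Lemma submodule_val_preimage : submodule (val @^-1` L : set N).
Proof.
have [sL aL] := mL; split; first exact: subgroup_val_preimage.
by move=> a u Lu; rewrite /= submodule_val_act; exact: aL.
Qed.

Lemma closed_val_preimage : closed (val @^-1` L : set N).
Proof.
have /continuous_closedP := @subgroup_val_continuous _ _ (proj1 mH); exact.
Qed.

Local Notation Q := (quotient_lcmod submodule_val_preimage closed_val_preimage).

Definition subquotient_map : M -> Q :=
  (\pi_(quotient_group (proj1 submodule_val_preimage)))%qT \o subgroup_proj (proj1 mH).

Lemma subquotient_mapP : is_subquotient H L subquotient_map.
Proof.
have [sH aH] := mH.
split.
  by move=> x y Hx Hy; rewrite /subquotient_map/= subgroup_projD// quotient_group_piD.
split.
  move=> a x Hx; rewrite /subquotient_map /= [RHS]quotient_act_pi; congr (\pi _)%qT.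
  by apply: val_inj; rewrite submodule_val_act !subgroup_projK//; exact: aH.
split.
  apply/seteqP; split=> // u _; have [v ->] := quotient_group_piP u.
  by exists (val v); [exact: subgroup_valP|rewrite /subquotient_map /= subgroup_valK].
split.
  move=> x Hx; rewrite /subquotient_map /= -quotient_group_pi0.
  have := quotient_group_pi_eq (proj1 submodule_val_preimage)
    (subgroup_proj (proj1 mH) x) 0.
  by rewrite subr0 /= subgroup_projK.
split.
  move=> x; apply: (@continuous_comp (subspace H) (subgroup_type sH)).
    exact: (@subgroup_proj_continuous _ _ (proj1 mH) x).
  exact: pi_continuous.
move=> B oB; rewrite -image_comp subgroup_proj_image; apply: quotient_group_open.
by exists B.
Qed.

End SubquotientExistence.

Section Radicals.
Context (A : topologicalZmodType) (M : lcmod A).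
Implicit Types (S N U K : set M).

Lemma compact_parafiniteP N : compact_parafinite N <->
  [/\ submodule N, compact N &
      forall K, submodule K -> closed K -> finite_index N K -> N `<=` K].
Proof.
split=> [[mN [cN pN]]|[mN cN pN]]; last by split=> //; split=> // K mK cK _; exact: pN.
split=> // K mK cK fK; apply: (@subset_trans _ (N `&` K)); last by move=> ? [].
apply: pN; first exact: submoduleI.
- by apply: closedI => //; apply: compact_closed => //; exact: lc_hausdorff.
- by move=> ? [].
- by apply: finite_index_setI => //; [case: mN|case: mK].
Qed.

Lemma compact_parafinite_set0 : compact_parafinite ([set 0] : set M).
Proof.
apply/compact_parafiniteP; split; [exact: submodule_set0|exact: compact_set1|].
by move=> K [/subgroup0 K0 _] _ _ _ ->.
Qed.

Lemma compact_parafinite_sumset N N' : compact_parafinite N ->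
  compact_parafinite N' -> compact_parafinite (sumset N N').
Proof.
move=> /compact_parafiniteP[mN cN pN] /compact_parafiniteP[mN' cN' pN'].
have NNN' : N `<=` sumset N N' by apply: sumset_subl; case: mN' => /subgroup0.
have N'NN' : N' `<=` sumset N N' by apply: sumset_subr; case: mN => /subgroup0.
apply/compact_parafiniteP; split; [exact: submodule_sumset|exact: compact_sumset|].
move=> K mK cK fK; apply: sumset_sub; first by case: mK.
- by apply: pN => //; exact: finite_indexS fK.
- by apply: pN' => //; exact: finite_indexS fK.
Qed.

Lemma compact_parafinite_sub_compact_elements N :
  compact_parafinite N -> N `<=` compact_elements.
Proof. by move=> [[sN _] [cN _]] x Nx; exists N. Qed.

Lemma WflatP x : Wflat M x <-> exists2 N, compact_parafinite N & N x.
Proof.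
split; last by move=> [N pN Nx]; apply: sub_gen_subgroup; exists N.
pose W : set M := [set x | exists2 N, compact_parafinite N & N x].
move=> /(_ W); apply=> [|y [N pN Ny]]; last by exists N.
split; first by exists [set 0] => //; exact: compact_parafinite_set0.
move=> y z [N pN Ny] [N' pN' Nz]; exists (sumset N N').
  exact: compact_parafinite_sumset.
by apply: mem_sumset => //; apply: subgroupN => //; case: pN' => -[].
Qed.

Lemma compact_parafinite_sub_Wflat N : compact_parafinite N -> N `<=` Wflat M.
Proof. by move=> pN x Nx; apply/WflatP; exists N. Qed.

Lemma submodule_Wflat : submodule (Wflat M).
Proof.
split; first exact: subgroup_gen.
move=> a x /WflatP[N pN Nx]; apply/WflatP; exists N => //.
by have [[_ aN] _] := pN; exact: aN.
Qed.

Lemma closure_Wflat_compact_parafinite :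
  compact (closure (Wflat M)) -> compact_parafinite (closure (Wflat M)).
Proof.
move=> cW; apply/compact_parafiniteP; split=> //.
  exact/submodule_closure/submodule_Wflat.
move=> K mK cK fK; rewrite ((closure_id K).1 cK); apply: closureS => x.
move=> /WflatP[N pN Nx]; have /compact_parafiniteP[_ _ NK] := pN.
apply: (NK K mK cK) Nx; apply: finite_indexS fK => //.
by apply: subset_trans (@subset_closure _ _); exact: compact_parafinite_sub_Wflat.
Qed.

Definition purely_codiscrete U : Prop :=
  [/\ submodule U, open U & quotient_purely_discrete U].

Lemma purely_codiscreteP U : purely_codiscrete U <->
  [/\ submodule U, open U &
      forall S, submodule S -> finite_index S U -> S `<=` U].
Proof.
split=> [[mU oU [_ pU]]|[mU oU pU]].
  split=> // S mS fS; have sU : is_subgroup U by case: mU.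
  apply: (@subset_trans _ (sumset S U)); first by apply: sumset_subl; exact: subgroup0.
  apply: pU; first exact: submodule_sumset.
    by apply: sumset_subr; apply: subgroup0; case: mS.
  exact: finite_index_sumset.
split=> //; split=> [x|S mS _]; first exact: coset_open.
exact: pU.
Qed.

Lemma purely_codiscrete_setT : purely_codiscrete [set: M].
Proof. by apply/purely_codiscreteP; split=> //; exact: openT. Qed.

Lemma purely_codiscreteI U U' :
  purely_codiscrete U -> purely_codiscrete U' -> purely_codiscrete (U `&` U').
Proof.
move=> /purely_codiscreteP[mU oU pU] /purely_codiscreteP[mU' oU' pU'].
apply/purely_codiscreteP; split; [exact: submoduleI|exact: openI|move=> S mS fS].
rewrite subsetI; split; [apply: pU|apply: pU'] => //;
  by apply: finite_indexS fS => // x [].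
Qed.

Lemma open_core_sub_purely_codiscrete U : purely_codiscrete U -> open_core `<=` U.
Proof. by move=> [[sU _] oU _] x; exact. Qed.

Lemma OmegasharpE : Omegasharp M = \bigcap_(U in purely_codiscrete) U.
Proof.
apply/seteqP; split=> x Ox U; first by move=> [mU oU qU]; exact: Ox.
by move=> mU oU qU; exact: Ox.
Qed.

Lemma submodule_Omegasharp : submodule (Omegasharp M).
Proof. by rewrite OmegasharpE; apply: submodule_bigcap => U []. Qed.

Lemma Omegasharp_sub_purely_codiscrete U : purely_codiscrete U -> Omegasharp M `<=` U.
Proof. by rewrite OmegasharpE => pU x; exact. Qed.

Lemma open_Omegasharp_purely_codiscrete :
  open (Omegasharp M) -> purely_codiscrete (Omegasharp M).
Proof.
move=> oO; apply/purely_codiscreteP; split=> //; first exact: submodule_Omegasharp.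
move=> S mS fS; rewrite OmegasharpE => x Sx U pU.
have /purely_codiscreteP[_ _ SU] := pU; apply: SU Sx => //.
by apply: finite_indexS fS => //; exact: Omegasharp_sub_purely_codiscrete.
Qed.

Lemma Wflat_sub_Omegasharp : Wflat M `<=` Omegasharp M.
Proof.
rewrite OmegasharpE => x /WflatP[N [mN [cN _]] Nx] U.
move=> /purely_codiscreteP[[sU _] oU pU]; apply: pU Nx => //.
by apply: compact_finite_index => //; exact: open_subgroup_nbhs0.
Qed.

End Radicals.

Lemma compactly_generatedP (A : topologicalZmodType) : compactly_generated A <->
  exists K : set A,
    [/\ compact K, gen_subgroup K = [set: A] & forall a, K a -> K (- a)].
Proof.
split=> [[K [cK gK]]|[K [cK gK _]]]; last by exists K.
exists (K `|` -%R @` K); split.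
- apply: compactU => //; apply: continuous_compact cK.
  by apply: continuous_subspaceT; exact: opp_continuous.
- apply/seteqP; split=> // a _ H sH KH.
  have : gen_subgroup K a by rewrite gK.
  by apply=> // b Kb; apply: KH; left.
- by move=> a [Ka|[b Kb <-]]; [right; exists a|left; rewrite opprK].
Qed.

Section CompactlyGeneratedAction.
Context (A : topologicalZmodType) (M : lcmod A) (K : set A).
Hypotheses (cK : compact K) (gK : gen_subgroup K = [set: A])
  (KN : forall a, K a -> K (- a)).
Implicit Types (C S U N V : set M).

Lemma submodule_generated_action S : is_subgroup S ->
  (forall a x, K a -> S x -> S (act M a x)) -> submodule S.
Proof.
move=> sS KS; split=> // a x Sx.
pose H := [set a | forall x, S x -> S (act M a x) /\ S (act M (- a) x)].
suff /(_ x Sx)[] : H a by [].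
have : gen_subgroup K a by rewrite gK.
apply=> [|b Kb y Sy]; last by split; apply: KS => //; exact: KN.
split=> [y Sy|b c Hb Hc y Sy]; first by rewrite oppr0 act_zero.
rewrite opprB [c - b]addrC !act_comp.
by split; [exact: (Hb _ (Hc _ Sy).2).1|exact: (Hb _ (Hc _ Sy).1).2].
Qed.

Lemma nbhs0_act U : nbhs 0 U -> nbhs 0 [set x : M | forall a, K a -> U (act M a x)].
Proof.
have /compact_near_coveringP nK := cK => U0.
apply: (nK _ _ (fun x a => U (act M a x))) => a Ka.
by have := @act_continuous A M (a, 0) U; rewrite /= act0; exact.
Qed.

Section OpenOmegasharp.
Variables C V : set M.
Hypotheses (oC : open_subgroups C) (cV : compact V) (CV : C `<=` sumset open_core V).

Lemma finite_index_act_compact_mod_core :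
  finite_index [set act M a x | a in K & x in C] C.
Proof.
have [sC openC] := oC.
have /finite_indexP[F fF KVF] : finite_index [set act M a x | a in K & x in V] C.
  apply: compact_finite_index (open_subgroup_nbhs0 sC openC).
  by apply: compact_image2 => //; exact: act_continuous.
apply/finite_indexP; exists F => // _ [a Ka [x /CV[d Dd [v Vv <-]] <-]].
have [|z Fz [c Cc zcE]] := KVF (act M a v); first by exists a => //; exists v.
rewrite act_add -zcE addrCA; apply: mem_sumset => //.
by apply: subgroupD => //; exact: (open_core_act a Dd).
Qed.

Lemma purely_codiscrete_compact_mod_core_finite_index U :
  purely_codiscrete U -> finite_index C U.
Proof.
move=> pU; have [[sU _] oU _] := pU.
have /finite_indexP[F fF VF] := compact_finite_index cV (open_subgroup_nbhs0 sU oU).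
apply/finite_indexP; exists F => // _ /CV[d Dd [v /VF[z Fz [u Uu <-]] <-]].
rewrite addrCA; apply: mem_sumset => //; apply: subgroupD => //.
exact: (open_core_sub_purely_codiscrete pU).
Qed.

Lemma open_sub_Omegasharp :
  exists2 U, purely_codiscrete U & C `&` U `<=` Omegasharp M.
Proof.
have [sC _] := oC.
have [||U pU Umin] := finite_index_minimal_trace (P := @purely_codiscrete A M) sC
    finite_index_act_compact_mod_core.
- by exists setT; exact: purely_codiscrete_setT.
- by move=> U [[]].
exists U => //; have [mU oU _] := pU; have [sU aU] := mU.
rewrite OmegasharpE => x [Cx Ux] U0 pU0.
pose U' := U `&` U0; have pU' : purely_codiscrete U' by exact: purely_codiscreteI.
have /purely_codiscreteP[mU' _ maxU'] := pU'; have [sU' aU'] := mU'.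
suff : U' x by case.
have sCU : is_subgroup (C `&` U) by exact: subgroupI.
have mCUU' : submodule (sumset (C `&` U) U').
  apply: submodule_generated_action; first exact: subgroup_sumset.
  move=> a _ Ka [c [Cc Uc] [u U'u <-]]; rewrite act_add.
  apply: sumset_subgroupK => //; apply: mem_sumset; last exact: aU'.
  apply: Umin => //; first by move=> ? [].
  by split; [exists a => //; exists c|exact: aU].
apply: (maxU' _ mCUU'); last by apply: sumset_subl => //; exact: subgroup0.
apply: finite_index_sumset => //.
exact: finite_indexS (purely_codiscrete_compact_mod_core_finite_index pU').
Qed.

End OpenOmegasharp.

Lemma open_Omegasharp : open (Omegasharp M).
Proof.
have [C [V [[sC oC] cV CV]]] := open_subgroup_compact_mod_core (@lc_locally_compact A M).
have [U [[sU _] oU _] CUO] := open_sub_Omegasharp (conj sC oC) cV CV.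
apply: subgroup_open; first by case: (submodule_Omegasharp M).
by apply: filterS CUO _; apply: filterI; exact: open_subgroup_nbhs0.
Qed.

Definition act_inner C : set M := [set x | C x /\ forall a, K a -> C (act M a x)].

Section CompactWflat.
Variables C U : set M.
Hypotheses (sC : is_subgroup C) (cC : compact C) (U0 : nbhs 0 U).
Hypotheses (CH : C `<=` closure compact_elements)
  (HU : closure compact_elements `&` U `<=` C).

Lemma subgroup_act_inner : is_subgroup (act_inner C).
Proof.
split; first by split=> [|a _]; rewrite ?act0; exact: subgroup0.
move=> x y [Cx aCx] [Cy aCy]; split=> [|a Ka]; first exact: subgroupB.
by rewrite actB; apply: subgroupB; [|exact: aCx|exact: aCy].
Qed.

Lemma finite_index_act_inner : finite_index C (act_inner C).
Proof.
apply: (compact_subgroup_finite_index cC sC (filterI U0 (nbhs0_act U0))).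
move=> x [/CH Hx [Ux KUx]]; split=> [|a Ka]; apply: HU; split=> //.
  by apply: closure_act Hx => y; exact: compact_elements_act.
exact: KUx.
Qed.

(* [N `&` (C + N0)] is [K]-stable, so it is a submodule of finite index in [N]. *)
Lemma compact_parafinite_sub_sumset N N0 :
  compact_parafinite N -> compact_parafinite N0 -> N0 `<=` N ->
  C `&` N `<=` sumset (act_inner C) N0 -> N `<=` sumset C N0.
Proof.
move=> pN [[sN0 aN0] [cN0 _]] N0N CN.
have NH := compact_parafinite_sub_compact_elements pN.
have /compact_parafiniteP[[sN aN] cN minN] := pN; have hM := @lc_hausdorff A M.
have sCN0 : is_subgroup (sumset C N0) by exact: subgroup_sumset.
suff : N `<=` N `&` sumset C N0 by move=> sub x /sub[].
apply: minN.
- apply: submodule_generated_action; first exact: subgroupI.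
  move=> a x Ka [Nx [c Cc [n N0n cnE]]]; split; first exact: aN.
  have Nc : N c by rewrite -(addrK n c) cnE; apply: subgroupB => //; exact: N0N.
  have [c' [_ KCc'] [n' N0n' c'n'E]] := CN c (conj Cc Nc).
  rewrite -cnE -c'n'E -addrA act_add.
  by apply: mem_sumset; [exact: KCc'|apply: aN0; exact: subgroupD].
- by apply: closedI; apply: compact_closed => //; exact: compact_sumset.
- apply: (compact_subgroup_finite_index cN sN U0) => x [Nx Ux]; split=> //.
  apply: sumset_subl; first exact: subgroup0.
  by apply: HU; split=> //; apply: subset_closure; exact: NH.
Qed.

Lemma Wflat_sub_compact : exists2 X, compact X & Wflat M `<=` X.
Proof.
have [|N0 pN0 N0max] := finite_index_maximal_trace (P := @compact_parafinite A M)
    subgroup_act_inner finite_index_act_inner.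
  by exists [set 0]; exact: compact_parafinite_set0.
have [[sN0 _] [cN0 _]] := pN0.
exists (sumset C N0); first exact: compact_sumset.
move=> x /WflatP[N pN Nx]; have [[sN _] _] := pN.
have pNN0 : compact_parafinite (sumset N N0) by exact: compact_parafinite_sumset.
have N0NN0 : N0 `<=` sumset N N0 by apply: sumset_subr; exact: subgroup0.
apply: (compact_parafinite_sub_sumset pNN0 pN0 N0NN0); first exact: N0max.
by apply: sumset_subl => //; exact: subgroup0.
Qed.

End CompactWflat.

Lemma compact_parafinite_Wflat : compact_parafinite (Wflat M).
Proof.
have [C [U [sC cC CH U0 HU]]] :=
  compact_subgroup_open_in_compact_elements (@lc_locally_compact A M).
have [X cX WX] := Wflat_sub_compact sC cC U0 CH HU.
have pW : compact_parafinite (closure (Wflat M)).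
  apply: closure_Wflat_compact_parafinite.
  have /closure_id clX : closed X by apply: compact_closed cX; exact: lc_hausdorff.
  apply: (subclosed_compact _ cX); first exact: closed_closure.
  by rewrite clX; exact: closureS.
rewrite (_ : Wflat M = closure (Wflat M))//; apply/seteqP.
by split; [exact: subset_closure|exact: compact_parafinite_sub_Wflat].
Qed.

End CompactlyGeneratedAction.

Section Subquotients.
Context (A : topologicalZmodType) (M Q : lcmod A) (H L : set M) (pi : M -> Q).
Hypotheses (mH : submodule H) (pi_sq : is_subquotient H L pi).

Let sH : is_subgroup H. Proof. by case: mH. Qed.

Lemma subquotientD x y : H x -> H y -> pi (x + y) = pi x + pi y.
Proof. by case: pi_sq => + _; exact. Qed.

Lemma subquotientB : additive_on H pi.
Proof.
move=> x y Hx Hy; apply: (addIr (pi y)); rewrite subrK -subquotientD ?subrK//.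
exact: subgroupB.
Qed.

Lemma subquotient_act a x : H x -> pi (act M a x) = act Q a (pi x).
Proof. by case: pi_sq => _ [+ _]; exact. Qed.

Lemma subquotient_surj q : exists2 x, H x & pi x = q.
Proof. by case: pi_sq => _ [_ [piH _]]; have : [set: Q] q by []; rewrite -piH. Qed.

Lemma subquotient_ker x : H x -> pi x = 0 <-> L x.
Proof. by case: pi_sq => _ [_ [_ [+ _]]]; exact. Qed.

Lemma subquotient_eq x y : H x -> H y -> pi x = pi y -> L (x - y).
Proof.
move=> Hx Hy xy; apply/subquotient_ker; first exact: subgroupB.
by rewrite subquotientB// xy subrr.
Qed.

Lemma subquotient_continuous : {within H, continuous pi}.
Proof. by case: pi_sq => _ [_ [_ [_ []]]]. Qed.

Lemma subquotient_open (O : set M) : open O -> open (pi @` (H `&` O)).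
Proof. by case: pi_sq => _ [_ [_ [_ [_ +]]]]; exact. Qed.

Lemma subquotient_image_preimage (S : set Q) : pi @` (H `&` pi @^-1` S) = S.
Proof.
apply/seteqP; split=> [_ [x [_ Sx] <-]//|q Sq].
by have [x Hx xq] := subquotient_surj q; exists x => //; split; rewrite /= ?xq.
Qed.

Lemma ker_sub_subquotient_preimage (S : set Q) :
  L `<=` H -> S 0 -> L `<=` H `&` pi @^-1` S.
Proof.
move=> LH S0 x Lx; split; first exact: LH.
by rewrite /= (subquotient_ker (LH _ Lx)).2.
Qed.

Lemma subquotient_preimage_image_sub (S : set M) :
  is_subgroup S -> L `<=` S -> S `<=` H -> H `&` pi @^-1` (pi @` S) `<=` S.
Proof.
move=> sS LS SH x [Hx [y Sy yx]]; rewrite -(subrK y x); apply: subgroupD => //.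
by apply: LS; apply: subquotient_eq => //; exact: SH.
Qed.

Lemma submodule_subquotient_preimage (S : set Q) :
  submodule S -> submodule (H `&` pi @^-1` S).
Proof.
move=> [sS aS]; split; first exact: (subgroup_preimage sH subquotientB).
move=> a x [Hx Sx]; have [_ aH] := mH; split; first exact: aH.
by rewrite /= subquotient_act//; exact: aS.
Qed.

Lemma submodule_subquotient_image (S : set M) :
  submodule S -> S `<=` H -> submodule (pi @` S).
Proof.
move=> [sS aS] SH; split; first exact: (subgroup_image sH subquotientB).
move=> a _ [x Sx <-]; exists (act M a x); first exact: aS.
by rewrite subquotient_act//; exact: SH.
Qed.

Lemma finite_index_subquotient_image (S T : set M) : is_subgroup T ->
  S `<=` H -> T `<=` H -> finite_index S T -> finite_index (pi @` S) (pi @` T).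
Proof.
move=> sT SH TH /(finite_index_representatives sT)[F [fF FS SF]].
apply/finite_indexP; exists (pi @` F); first exact: finite_image.
move=> _ [_ /SF[x Fx [t Tt <-]] <-].
rewrite subquotientD; [|exact/SH/FS|exact: TH].
by apply: mem_sumset; [exists x|exists t].
Qed.

Lemma closed_subquotient_preimage (S : set Q) : closed H -> closed S ->
  closed (H `&` pi @^-1` S).
Proof.
move=> cH cS; rewrite closed_setSI//.
by have /continuous_closedP := subquotient_continuous; exact.
Qed.

Lemma open_subquotient_preimage (S : set Q) : open H -> open S ->
  open (H `&` pi @^-1` S).
Proof.
move=> oH oS; rewrite open_setSI//.
by have /continuousP := subquotient_continuous; exact.
Qed.

Lemma compact_subquotient_preimage (N : set Q) : closed H -> compact L -> compact N ->
  compact (H `&` pi @^-1` N).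
Proof.
move=> cH cL cN; have [V V0 cV] := locally_compact_nbhs 0 (@lc_locally_compact A M).
have [||F [fF FH NF]] :=
    @compact_finite_subcover _ _ _ H (fun x => pi @` (H `&` [set y | V° (y - x)])) cN.
- by move=> x _; apply/subquotient_open/open_translate; exact: open_interior.
- move=> q _; have [x Hx xq] := subquotient_surj q.
  exists x => //; exists x => //; split=> //=; rewrite subrr.
  by apply: nbhs_singleton; exact: nbhs_interior.
apply: (@subclosed_compact _ _ (sumset F (sumset V L))).
- apply: closed_subquotient_preimage => //.
  by apply: compact_closed cN; exact: lc_hausdorff.
- by do 2?apply: compact_sumset => //; exact: finite_compact.
move=> x [Hx /NF[y Fy [z [Hz /interior_subset Vzy] zx]]].
have -> : x = y + (z - y + (x - z)) by rewrite [z - y + _]addrC subrKA addrC subrK.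
by do 2?apply: mem_sumset => //; exact: (subquotient_eq Hx Hz (esym zx)).
Qed.

Lemma compact_parafinite_subquotient_preimage (N : set Q) :
  closed H -> L `<=` H -> compact_parafinite L -> compact_parafinite N ->
  compact_parafinite (H `&` pi @^-1` N).
Proof.
move=> cH LH /compact_parafiniteP[mL cL minL] /compact_parafiniteP[mN cN minN].
set P := H `&` _; have PH : P `<=` H by move=> x [].
have LP : L `<=` P by apply: ker_sub_subquotient_preimage => //; case: mN => /subgroup0.
have mP : submodule P by exact: submodule_subquotient_preimage.
have cP : compact P by exact: compact_subquotient_preimage.
have sP : is_subgroup P by case: mP.
split=> //; split=> // K mK clK KP fK; have sK : is_subgroup K by case: mK.
have LK : L `<=` K by apply: minL => //; exact: finite_indexS fK.
have KH : K `<=` H by move=> x /KP[].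
have NK : N `<=` pi @` K.
  apply: minN; first exact: submodule_subquotient_image.
    apply: compact_closed; first exact: lc_hausdorff.
    apply: continuous_compact; last exact: subclosed_compact KP.
    exact: continuous_subspaceW KH subquotient_continuous.
  rewrite -(subquotient_image_preimage N).
  exact: finite_index_subquotient_image.
apply: subset_trans (subquotient_preimage_image_sub sK LK KH) => x [Hx /NK piKx].
by split.
Qed.

Lemma purely_codiscrete_subquotient_preimage (U : set Q) :
  purely_codiscrete H -> purely_codiscrete U -> purely_codiscrete (H `&` pi @^-1` U).
Proof.
move=> /purely_codiscreteP[_ oH maxH] /purely_codiscreteP[mU oU maxU].
set P := H `&` _; have PH : P `<=` H by move=> x [].
have mP : submodule P by exact: submodule_subquotient_preimage.
apply/purely_codiscreteP; split=> //; first exact: open_subquotient_preimage.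
move=> S mS fS; have SH : S `<=` H by apply: maxH => //; exact: finite_indexS fS.
have SU : pi @` S `<=` U.
  apply: maxU; first exact: submodule_subquotient_image.
  rewrite -(subquotient_image_preimage U); apply: finite_index_subquotient_image => //.
  by case: mP.
by move=> x Sx; split; [exact: SH|apply: SU; exists x].
Qed.

End Subquotients.

Section RadicalSubquotient.
Context (A : topologicalZmodType) (M Q : lcmod A) (pi : M -> Q).
Hypotheses (oO : open (Omegasharp M)) (pW : compact_parafinite (Wflat M)).
Hypothesis pi_sq : is_subquotient (Omegasharp M) (Wflat M) pi.

Let mO := @submodule_Omegasharp A M.

Lemma Wflat_radical_subquotient : Wflat Q = [set 0].
Proof.
apply/seteqP; split=> [q /WflatP[N pN Nq]|_ ->]; last first.
  by apply: subgroup0; case: (submodule_Wflat Q).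
have cO : closed (Omegasharp M) by apply: open_subgroup_closed => //; case: mO.
have [x Ox xq] := subquotient_surj pi_sq q.
rewrite /= -xq; apply/(subquotient_ker pi_sq Ox).
apply: (@compact_parafinite_sub_Wflat _ _ (Omegasharp M `&` pi @^-1` N)).
  apply: (compact_parafinite_subquotient_preimage mO pi_sq) => //.
  exact: Wflat_sub_Omegasharp.
by split=> //=; rewrite xq.
Qed.

Lemma Omegasharp_radical_subquotient : Omegasharp Q = [set: Q].
Proof.
apply/seteqP; split=> // q _; rewrite OmegasharpE => U pU.
have [x Ox <-] := subquotient_surj pi_sq q.
have pP := purely_codiscrete_subquotient_preimage mO pi_sq
  (open_Omegasharp_purely_codiscrete oO) pU.
by have [] := Omegasharp_sub_purely_codiscrete pP Ox.
Qed.

End RadicalSubquotient.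

Theorem mainTheorem2 (A : topologicalZmodType) (M : lcmod A) :
  LCA A ->
  [/\ submodule (Wflat M), submodule (Omegasharp M),
      [set 0] `<=` Wflat M, Wflat M `<=` Omegasharp M &
      Omegasharp M `<=` [set: lc_car M]] /\
  (compactly_generated A ->
   [/\ compact_parafinite (Wflat M),
       open (Omegasharp M),
       quotient_purely_discrete (Omegasharp M),
       (exists (Q : lcmod A) (pi : M -> Q),
           is_subquotient (Omegasharp M) (Wflat M) pi) &
       (forall (Q : lcmod A) (pi : M -> Q),
           is_subquotient (Omegasharp M) (Wflat M) pi -> sheer Q)]).
Proof.
move=> _; have mW := submodule_Wflat M; have mO := submodule_Omegasharp M.
split.
  split=> //; last exact: Wflat_sub_Omegasharp.
  by move=> _ ->; apply: subgroup0; case: mW.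
move=> /compactly_generatedP[K [cK gK KN]].
have pW : compact_parafinite (Wflat M) by exact: compact_parafinite_Wflat cK gK KN.
have oO : open (Omegasharp M) by exact: open_Omegasharp cK gK KN.
have clW : closed (Wflat M).
  by have [_ [cW _]] := pW; apply: compact_closed cW; exact: lc_hausdorff.
have clO : closed (Omegasharp M) by apply: open_subgroup_closed => //; case: mO.
split=> //.
- by have [] := open_Omegasharp_purely_codiscrete oO.
- exact: (ex_intro _ _ (ex_intro _ _ (subquotient_mapP mO clO mW clW))).
move=> Q pi pi_sq; split; first exact: Wflat_radical_subquotient pi_sq.
exact: Omegasharp_radical_subquotient pi_sq.
Qed.
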